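(* Let $K$ be a (nonempty) compact Hausdorff space, $E$ a Banach space, and $T$ an operator from $X=C(K,E)$ into some Banach space. Then the following conditions are equivalent: (1) $T$ is a strong Daugavet operator. (2) For every closed proper subset $V\subsetneq K$, every $x\in S(E)$, every $y\in B(E)$ and every $\varepsilon>0$ there exist a nonempty open subset $W\subset K\setminus V$, an element $e\in E$ with $\|e+y\|<1+\varepsilon$ and $\|e+y+x\|>2-\varepsilon$, and a function $h\in X_V$ with $\|h\|\le 2+\varepsilon$, such that $\|Th\|<\varepsilon$ and $\|e-h(t)\|<\varepsilon$ for all $t\in W$. (3) For every closed proper subset $V\subsetneq K$, every $x\in S(E)$, every $y\in B(E)$ and every $\varepsilon>0$ there exists a function $f\in X_V$ such that $\|Tf\|<\varepsilon$, $\|f+y\|<1+\varepsilon$ and $\|f+y+x\|>2-\varepsilon$ (here $x,y$ are regarded as constant functions on $K$). If $K$ has no isolated points, then these conditions are equivalent to (4) $T$ is a narrow operator.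
   Context: Banach spaces are real and ''operator'' means bounded linear operator between Banach spaces. For a Banach space $X$, $B(X)$ is the closed unit ball and $S(X)$ the unit sphere. $C(K,E)$ is the Banach space of continuous functions $K\to E$ with the sup-norm; for $X=C(K,E)$ and $V\subset K$, $X_V=\{f\in X: f(t)=0 \text{ for all } t\in V\}$. An operator $T: X\to Z$ is a strong Daugavet operator if for every $x,y\in S(X)$ and every $\varepsilon>0$ there is $u\in B(X)$ with $\|x+u\|>2-\varepsilon$ and $\|T(y-u)\|<\varepsilon$. An operator $T: X\to Z$ is narrow if for every $x,y\in S(X)$, every $x^*\in X^*$ and every $\varepsilon>0$ there is $u\in B(X)$ with $\|x+u\|>2-\varepsilon$ and $\|T(y-u)\|+|x^*(y-u)|<\varepsilon$. *)

(* Defs.v *)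
From HB Require Import structures.
From mathcomp Require Import all_boot all_order all_algebra.
From mathcomp Require Import all_classical all_reals all_analysis.
From mathcomp Require Import ring lra.

Set Implicit Arguments.
Unset Strict Implicit.
Unset Printing Implicit Defensive.

Import Order.TTheory GRing.Theory Num.Theory.
Import numFieldNormedType.Exports.

Local Open Scope classical_set_scope.
Local Open Scope ring_scope.

(* C(K, E) for K compact. The compactness proof [cK] is a phantom parameter of
   the type: the sup-norm is a norm only because K is compact, so this is what
   lets the Banach space structure be inferred from the type. *)
Definition cspace (K : topologicalType) (cK : compact [set: K])
  (R : realType) (E : completeNormedModType R) : Type := continuousType K E.

Definition cspace_fun (K : topologicalType) (cK : compact [set: K])
  (R : realType) (E : completeNormedModType R) (f : cspace cK E) : K -> E :=
  (f : continuousType K E).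
Coercion cspace_fun : cspace >-> Funclass.

Section cspace_banach.
Context {K : topologicalType} (cK : compact [set: K])
  {R : realType} {E : completeNormedModType R}.
Local Notation C := (cspace cK E).
Implicit Types (f g h : C) (a b : R) (t : K).

Lemma cspace_continuous f : continuous f.
Proof. exact: cts_fun. Qed.

Definition mkcspace (f : K -> E) (cf : continuous f) : C :=
  [the continuousType K E of mkcts cf].

Lemma cspaceP f g : (forall t, f t = g t) -> f = g.
Proof. by move=> fg; apply/continuousEP. Qed.

HB.instance Definition _ := Choice.copy C (continuousType K E).

Definition cspace_const (e : E) : C := mkcspace (fun=> cvg_cst e).

Lemma continuousDf f g : continuous (fun t => f t + g t).
Proof. by move=> t; apply: cvgD; exact: cspace_continuous. Qed.

Lemma continuousNf f : continuous (fun t => - f t).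
Proof. by move=> t; apply: cvgN; exact: cspace_continuous. Qed.

Lemma continuousZf a f : continuous (fun t => a *: f t).
Proof. by move=> t; apply: cvgZr; exact: cspace_continuous. Qed.

Definition cspace_add f g : C := mkcspace (@continuousDf f g).
Definition cspace_opp f : C := mkcspace (@continuousNf f).
Definition cspace_scale a f : C := mkcspace (@continuousZf a f).

Lemma cspace_addA : associative cspace_add.
Proof. by move=> f g h; apply: cspaceP => t; exact: addrA. Qed.
Lemma cspace_addC : commutative cspace_add.
Proof. by move=> f g; apply: cspaceP => t; exact: addrC. Qed.
Lemma cspace_add0 : left_id (cspace_const 0) cspace_add.
Proof. by move=> f; apply: cspaceP => t; exact: add0r. Qed.
Lemma cspace_addN : left_inverse (cspace_const 0) cspace_opp cspace_add.
Proof. by move=> f; apply: cspaceP => t; exact: addNr. Qed.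

HB.instance Definition _ := GRing.isZmodule.Build C
  cspace_addA cspace_addC cspace_add0 cspace_addN.

Lemma cspace_scaleA a b f :
  cspace_scale a (cspace_scale b f) = cspace_scale (a * b) f.
Proof. by apply: cspaceP => t; exact: scalerA. Qed.
Lemma cspace_scale1 : left_id 1 cspace_scale.
Proof. by move=> f; apply: cspaceP => t; exact: scale1r. Qed.
Lemma cspace_scaleDr : right_distributive cspace_scale +%R.
Proof. by move=> a f g; apply: cspaceP => t; exact: scalerDr. Qed.
Lemma cspace_scaleDl f : {morph cspace_scale^~ f : a b / a + b}.
Proof. by move=> a b; apply: cspaceP => t; exact: scalerDl. Qed.

HB.instance Definition _ := GRing.Zmodule_isLmodule.Build R C
  cspace_scaleA cspace_scale1 cspace_scaleDr cspace_scaleDl.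

Lemma cspaceDE f g t : (f + g : C) t = f t + g t. Proof. by []. Qed.
Lemma cspaceNE f t : (- f : C) t = - f t. Proof. by []. Qed.
Lemma cspaceZE a f t : (a *: f : C) t = a *: f t. Proof. by []. Qed.
Lemma cspace0E t : (0 : C) t = 0. Proof. by []. Qed.
Lemma cspace_constE e t : cspace_const e t = e. Proof. by []. Qed.

(* [sup set0 = 0], so this is also correct when K is empty. *)
Definition cspace_norm f : R := sup (range (fun t => `|f t|)).

Lemma cspace_has_ubound f : has_ubound (range (fun t => `|f t|)).
Proof.
have /compact_bounded[M [_ fM]] : compact (range f).
  apply: continuous_compact => //.
  by apply: continuous_subspaceT; exact: cspace_continuous.
exists (M + 1) => _ [t _ <-]; apply: fM; last by exists t.
by rewrite ltrDl.
Qed.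

Lemma ler_cspace_norm f t : `|f t| <= cspace_norm f.
Proof. by apply: ub_le_sup; [exact: cspace_has_ubound|exists t]. Qed.

Lemma cspace_norm_le f a : 0 <= a -> (forall t, `|f t| <= a) ->
  cspace_norm f <= a.
Proof.
move=> a0 fa; rewrite /cspace_norm.
have [->|/set0P ne] := eqVneq (range (fun t => `|f t|)) set0.
  by rewrite sup0.
by apply: ge_sup => // _ [t _ <-]; exact: fa.
Qed.

Lemma cspace_norm_ge0 f : 0 <= cspace_norm f.
Proof.
have [r0|/set0P[_ [t _ _]]] := eqVneq (range (fun t => `|f t|)) set0.
  by rewrite /cspace_norm r0 sup0.
exact: le_trans (ler_cspace_norm f t).
Qed.

Lemma cspace_normD f g : cspace_norm (f + g) <= cspace_norm f + cspace_norm g.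
Proof.
apply: cspace_norm_le; first by rewrite addr_ge0// cspace_norm_ge0.
by move=> t; rewrite (le_trans (ler_normD _ _))// lerD// ler_cspace_norm.
Qed.

Lemma cspace_normZ_le a f : cspace_norm (a *: f) <= `|a| * cspace_norm f.
Proof.
apply: cspace_norm_le; first by rewrite mulr_ge0// cspace_norm_ge0.
by move=> t; rewrite cspaceZE normrZ ler_wpM2l// ler_cspace_norm.
Qed.

Lemma cspace_normZ a f : cspace_norm (a *: f) = `|a| * cspace_norm f.
Proof.
apply/eqP; rewrite eq_le cspace_normZ_le /=.
have [->|a0] := eqVneq a 0; first by rewrite normr0 mul0r cspace_norm_ge0.
have := cspace_normZ_le a^-1 (a *: f).
by rewrite scalerA mulVf// scale1r normfV mulrC ler_pdivlMr ?normr_gt0// mulrC.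
Qed.

Lemma cspace_norm0_eq0 f : cspace_norm f = 0 -> f = 0.
Proof.
move=> f0; apply: cspaceP => t; apply/eqP.
by rewrite -normr_le0 -f0 ler_cspace_norm.
Qed.

HB.instance Definition _ := Lmodule_isNormed.Build R C
  cspace_normD cspace_normZ cspace_norm0_eq0.

Lemma cspace_normE f : `|f| = sup (range (fun t => `|f t|)).
Proof. by []. Qed.

Lemma cspace_dist_le f g t : `|f t - g t| <= `|f - g|.
Proof. exact: (ler_cspace_norm (f - g : C) t). Qed.

Lemma cspace_complete (F : set_system C) :
  ProperFilter F -> cauchy F -> cvg F.
Proof.
move=> FF /cauchyP FC.
have {}FC (e : R) : 0 < e -> exists f0 : C, F [set g : C | `|f0 - g| < e].
  by move=> e0; have [f0 Ff0] := FC _ e0; exists f0; rewrite -ball_normE in Ff0.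
have cvgt t : cvg ((fun g : C => g t) @ F).
  apply: cauchy_cvg; apply/cauchyP => e e0; have [f0 Ff0] := FC _ e0.
  exists (f0 t); rewrite -ball_normE.
  suff : F [set g : C | `|f0 t - g t| < e] by [].
  by apply: filterS Ff0 => g; exact: le_lt_trans (cspace_dist_le f0 g t).
pose l t := lim ((fun g : C => g t) @ F).
have lF (e : R) : 0 < e -> F [set g : C | forall t, `|l t - g t| <= e].
  move=> e0; have e20 : 0 < e / 2 by rewrite divr_gt0.
  have [f0 Ff0] := FC _ e20.
  have lf0 t : `|l t - f0 t| <= e / 2.
    rewrite distrC.
    apply: (@closed_cvg _ _ F _ (fun g : C => g t)
      [set x : E | `|f0 t - x| <= e / 2] _ _ _ _).
    - have -> : [set x : E | `|f0 t - x| <= e / 2] =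
          (fun x => `|f0 t - x|) @^-1` [set r : R | r <= e / 2] by [].
      apply: closed_comp; last exact: closed_le.
      move=> x _; apply: (@cvg_norm _ _ _ (nbhs x)).
      by apply: cvgB; [exact: cvg_cst|exact: cvg_id].
    - apply: filterS Ff0 => g /ltW; exact: le_trans (cspace_dist_le f0 g t).
    - exact: cvgt.
  apply: filterS Ff0 => g f0g t; rewrite [e]splitr.
  rewrite (le_trans (ler_distD (f0 t) _ _))// lerD//.
  exact: le_trans (cspace_dist_le f0 g t) (ltW f0g).
have cl : continuous l.
  move=> t; apply/cvgrPdist_lt => e e0.
  have e30 : 0 < e / 3 by rewrite divr_gt0.
  have [g lg] := filter_ex (lF _ e30).
  have /cvgrPdist_lt/(_ _ e30) := @cspace_continuous g t.
  apply: filterS => s gts.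
  have -> : e = e / 3 + e / 3 + e / 3 by field.
  rewrite (le_lt_trans (ler_distD (g s) _ _))// ltr_leD//; last first.
    by rewrite distrC lg.
  by rewrite (le_lt_trans (ler_distD (g t) _ _))// ler_ltD.
apply/cvg_ex; exists (mkcspace cl); apply/cvgrPdist_le => e e0.
apply: filterS (lF _ e0) => g lg.
by apply: cspace_norm_le => [|t]; [exact: ltW|exact: lg].
Qed.

HB.instance Definition _ := Uniform_isComplete.Build C cspace_complete.

(* X_V for X = C(K, E) *)
Definition vanishing_on (V : set K) : set C :=
  [set f | forall t, V t -> f t = 0].

End cspace_banach.

Arguments cspace_const {K} cK {R E} e.
Arguments vanishing_on {K} cK {R} E V.

Definition unit_sphere (R : realType) (X : normedModType R) : set X :=
  [set x | `|x| = 1].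
Definition unit_ball (R : realType) (X : normedModType R) : set X :=
  [set x | `|x| <= 1].
Arguments unit_sphere {R} X.
Arguments unit_ball {R} X.

Section operators.
Context {R : realType} {X Z : completeNormedModType R}.

Definition strong_daugavet (T : {linear X -> Z}) : Prop :=
  forall x y, unit_sphere X x -> unit_sphere X y ->
  forall eps : R, 0 < eps ->
  exists u, [/\ unit_ball X u, `|x + u| > 2 - eps & `|T (y - u)| < eps].

Definition narrow (T : {linear X -> Z}) : Prop :=
  forall x y, unit_sphere X x -> unit_sphere X y ->
  forall xs : {linear X -> R^o}, bounded_fun_norm xs ->
  forall eps : R, 0 < eps ->
  exists u, [/\ unit_ball X u, `|x + u| > 2 - eps
              & `|T (y - u)| + `|xs (y - u)| < eps].

End operators.

(* Main.v *)
(* A vector s = v_1 + ... + v_n with |v_k| <= 1 + o(1) and |x + s| close to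
   n + 1 gives a mean s / n with |x + s / n| close to 2, and such v_k can be
   chosen one after the other, each aligned with the normalization of
   x + v_1 + ... + v_(k-1).
   (1) => (2): starting from u_0 = y, take u_(k+1) close to
   u_k - phi_k (u_k - y) modulo the near-kernel of T and aligned with
   phi_k x_k, where the bumps phi_k live on a decreasing sequence of open sets
   U_k outside V. The sum of the phi_k (u_k - y) vanishes on V and telescopes
   under T, so h is that sum divided by n.
   (2) => (3): average functions h_k given by (2), each vanishing off the open
   set W provided by the previous one; at each point at most one h_k + y fails
   to have norm about 1.
   (3) => (1): near a point where x almost attains its norm, y + f is the
   required u up to rescaling.
   (4): without isolated points, an open set contains many disjoint open sets;
   functions f as in (3) supported there, all with |x*(f)| >= eps, would sum up
   (with signs) to a bounded function with arbitrarily large x*. Hence (3) holds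
   for the seminorm |T f| + |x*(f)|, and (3) => (1) applies to it. *)
Require Import Defs.
From HB Require Import structures.
From mathcomp Require Import all_boot all_order all_algebra.
From mathcomp Require Import all_classical all_reals all_analysis.
From mathcomp Require Import ring lra.

Set Implicit Arguments.
Unset Strict Implicit.
Unset Printing Implicit Defensive.

Import Order.TTheory GRing.Theory Num.Theory.
Import numFieldNormedType.Exports.

Local Open Scope classical_set_scope.
Local Open Scope ring_scope.

(** * Norm estimates for aligned vectors *)

Section alignment.
Context {R : realType} {X : normedModType R}.
Implicit Types (p s v x : X) (eta : R).

(** With [q = |p|] and [x' = p / q], one has [q (v + x') = (p + v) + (q - 1) v], where the last term
    has norm at most [(q - 1) (1 + d)]. The tolerance is thus multiplied by less than [2 q], whence
    [d = eta / (2 q)]. *)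
Lemma align_step p eta : 0 < eta -> eta <= 1 -> 1 <= `|p| ->
  exists d x', [/\ 0 < d, d <= eta, `|x'| = 1
    & forall v, `|v| <= 1 + d -> 2 - d < `|v + x'| ->
      `|p| + 1 - eta <= `|p + v|].
Proof.
move=> eta0 eta1; set q := `|p| => p1.
have q0 : 0 < q by exact: lt_le_trans p1.
exists (eta / (2 * q)), (q^-1 *: p).
have dq : eta / (2 * q) * q = eta / 2 by field; rewrite gt_eqF.
have d0 : 0 < eta / (2 * q) by rewrite divr_gt0// mulr_gt0.
split => //.
- by rewrite ler_pdivrMr ?mulr_gt0// ler_peMr ?ltW//; lra.
- by rewrite normrZ gtr0_norm ?invr_gt0// mulVf// gt_eqF.
move: (eta / (2 * q)) d0 dq => d d0 dq v v1 vp.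
have : q * (2 - d) <= `|p + v| + (q - 1) * (1 + d).
  apply: (@le_trans _ _ (q * `|v + q^-1 *: p|)).
    by rewrite ler_pM2l// ltW.
  have -> : q * `|v + q^-1 *: p| = `|p + v + (q - 1) *: v|.
    rewrite -{1}(gtr0_norm q0) -normrZ scalerDr scalerA divff ?gt_eqF//.
    by rewrite scale1r scalerBl scale1r -addrA (addrC v) subrK addrC.
  rewrite (le_trans (ler_normD _ _))// lerD2l normrZ.
  by rewrite ger0_norm ?subr_ge0// ler_wpM2l// subr_ge0.
lra.
Qed.

(** [x + s] is [(s / n + x) + (1 - 1 / n) s], and the last summand has norm at most
    [(n - 1) (1 + eta)]. *)
Lemma align_mean n x s eta : (0 < n)%N -> 0 <= eta ->
  `|s| <= n%:R * (1 + eta) -> 1 + n%:R * (1 - eta) <= `|x + s| ->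
  2 - 2 * n%:R * eta <= `|n%:R^-1 *: s + x|.
Proof.
move=> n0 eta0 s1 xs.
have n1 : 1 <= n%:R :> R by rewrite ler1n.
have : `|x + s| <= `|n%:R^-1 *: s + x| + (1 - n%:R^-1) * `|s|.
  have -> : x + s = n%:R^-1 *: s + x + (1 - n%:R^-1) *: s.
    by rewrite scalerBl scale1r [RHS]addrC addrA subrK addrC.
  rewrite (le_trans (ler_normD _ _))// lerD2l normrZ.
  by rewrite ger0_norm// subr_ge0 invf_le1// (lt_le_trans _ n1).
have : (1 - n%:R^-1) * `|s| <= (n%:R - 1) * (1 + eta).
  have -> : (n%:R - 1) * (1 + eta) = (1 - n%:R^-1) * (n%:R * (1 + eta)).
    by field; rewrite gt_eqF// (lt_le_trans _ n1).
  by rewrite ler_wpM2l// subr_ge0 invf_le1// (lt_le_trans _ n1).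
nra.
Qed.

(** [n] comes first, so that division by [n] makes a fixed cost [M] small; then [eta] is so small
    that a few [eta] lost in each of [n] steps stay below [e]. *)
Lemma small_parameters (M e : R) : 0 < e ->
  exists (n : nat) (eta : R), [/\ (0 < n)%N, M < n%:R * e,
    0 < eta, eta <= 1 & 8 * n%:R * eta <= e].
Proof.
move=> e0; pose n := (Num.truncn (Num.max 0 (M / e))).+1.
have n0 : 0 < n%:R :> R by rewrite ltr0n.
exists n, (Num.min 1 (e / (8 * n%:R))); split => //.
- have : Num.max 0 (M / e) < n%:R by exact: truncnS_gt.
  by rewrite gt_max ltr_pdivrMr// => /andP[].
- by rewrite lt_min ltr01 divr_gt0// mulr_gt0.
- by rewrite ge_min lexx.
- rewrite mulrC -ler_pdivlMr ?mulr_gt0//.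
  by rewrite ge_min lexx orbT.
Qed.

End alignment.

(** * The strong Daugavet property for targets in the unit ball *)

Section ball.
Context {R : realType} {X Z : completeNormedModType R}.

(** The definition is used twice: [u1] approximates [a] under [T] and is aligned with [x], [u2]
    approximates [- a] and is aligned with [x + u1]. So [|x + u1 + u2|] is almost 3, and passing to
    [l *: u1 + m *: u2] only drops [m *: u1 + l *: u2], of norm at most 1. *)
Lemma strong_daugavet_ball (T : {linear X -> Z}) (x y : X) (e : R) :
  strong_daugavet T -> `|x| = 1 -> `|y| <= 1 -> 0 < e ->
  exists u, [/\ `|u| <= 1, 2 - e < `|x + u| & `|T (y - u)| < e].
Proof.
move=> sT x1 y1 e0.
have [a a1 ya] : exists2 a : X, `|a| = 1 & y = `|y| *: a.
  have [->|yn0] := eqVneq y 0; first by exists x => //; rewrite normr0 scale0r.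
  exists (`|y|^-1 *: y).
    by rewrite normrZ normfV normr_id mulVf// normr_eq0.
  by rewrite scalerA divff ?normr_eq0// scale1r.
have [n [eta [n0 _ eta0 eta1 etae]]] := small_parameters 0 e0.
have {n n0}etae : 8 * eta <= e.
  have : 1 <= n%:R :> R by rewrite ler1n.
  by nra.
have := @align_step _ _ x eta eta0 eta1; rewrite x1 lexx.
move=> /(_ isT)[d1 [x' [d10 d1e x'1 H1]]].
have [u1 [u11 xu1 Tu1]] := sT _ _ x'1 a1 _ d10.
have {H1}xu1 : 2 - eta <= `|x + u1|.
  have : 1 + 1 - eta <= `|x + u1|.
    apply: H1; last by rewrite (addrC u1).
    by rewrite (le_trans u11)// lerDl ltW.
  by lra.
have [|d2 [x'' [d20 d2e x''1 H2]]] := @align_step _ _ (x + u1) eta eta0 eta1.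
  by lra.
have Na1 : `|- a| = 1 by rewrite normrN.
have [u2 [u21 xu2 Tu2]] := sT _ _ x''1 Na1 _ d20.
have {H2}xu2 : 3 - 2 * eta <= `|x + u1 + u2|.
  have : `|x + u1| + 1 - eta <= `|x + u1 + u2|.
    apply: H2; last by rewrite (addrC u2).
    by rewrite (le_trans u21)// lerDl ltW.
  by lra.
(* [y] is a convex combination of the unit vectors [a] and [- a]. *)
have [l [m [l0 m0 lm yE]]] : exists l m : R,
    [/\ 0 <= l, 0 <= m, l + m = 1 & y = l *: a + m *: (- a)].
  exists ((1 + `|y|) / 2), ((1 - `|y|) / 2); split.
  - by rewrite divr_ge0// addr_ge0.
  - by rewrite divr_ge0// subr_ge0.
  - by field.
  - by rewrite scalerN -scalerBl {1}ya; congr (_ *: _); field.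
have lu1 : l * `|u1| <= l by rewrite ler_piMr.
have mu1 : m * `|u1| <= m by rewrite ler_piMr.
have lu2 : l * `|u2| <= l by rewrite ler_piMr.
have mu2 : m * `|u2| <= m by rewrite ler_piMr.
exists (l *: u1 + m *: u2); split.
- by rewrite (le_trans (ler_normD _ _))// !normrZ !ger0_norm//; lra.
- have : `|x + u1 + u2| <= `|x + (l *: u1 + m *: u2)| + m * `|u1| + l * `|u2|.
    have -> : x + u1 + u2 = x + (l *: u1 + m *: u2) + m *: u1 + l *: u2.
      rewrite -[in LHS](scale1r u1) -[in LHS](scale1r u2) -lm.
      rewrite !scalerDl -!addrA; congr (_ + _); congr (_ + _).
      by rewrite [in RHS]addrCA; congr (_ + _); rewrite addrC.
    rewrite (le_trans (ler_normD _ _))// normrZ (ger0_norm l0) lerD2r.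
    by rewrite (le_trans (ler_normD _ _))// normrZ (ger0_norm m0).
  by lra.
- have -> : y - (l *: u1 + m *: u2) = l *: (a - u1) + m *: (- a - u2).
    by rewrite yE !scalerBr opprD addrACA.
  rewrite linearD !linearZ /= (le_lt_trans (ler_normD _ _))//.
  rewrite !normrZ !ger0_norm//.
  have : l * `|T (a - u1)| <= l * eta by rewrite ler_wpM2l// ltW// (lt_le_trans Tu1).
  have : m * `|T (- a - u2)| <= m * eta.
    by rewrite ler_wpM2l// ltW// (lt_le_trans Tu2).
  by nra.
Qed.
End ball.

(** * Norms, scalar multipliers and Urysohn bumps in [C(K, E)] *)

Section local.
Context {R : realType} {K : topologicalType} (cK : compact [set: K])
  {E : completeNormedModType R}.
Local Notation C := (cspace cK E).
Local Notation cst := (cspace_const cK).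

Lemma cspace_norm_gt (f : C) a : [set: K] !=set0 -> a < `|f| ->
  exists t, a < `|f t|.
Proof.
move=> [t0 _] af; apply: contrapT => nt.
have fa t : `|f t| <= a by rewrite leNgt; apply/negP => ?; apply: nt; exists t.
move: af; rewrite ltNge => /negP; apply; apply: cspace_norm_le => //.
exact: le_trans (fa t0).
Qed.

Lemma cspace_const_norm (e : E) : [set: K] !=set0 -> `|cst e| = `|e|.
Proof.
move=> [t0 _]; apply/eqP; rewrite eq_le; apply/andP; split.
  by apply: cspace_norm_le.
exact: (ler_cspace_norm (cst e) t0).
Qed.

Lemma continuousZl_cspace (phi : K -> R) (f : C) :
  continuous phi -> continuous (fun t => phi t *: f t).
Proof.
by move=> cphi t; apply: cvgZ; [exact: cphi|exact: cspace_continuous].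
Qed.

Definition cspace_mul (phi : K -> R) (cphi : continuous phi) (f : C) : C :=
  mkcspace cK (@continuousZl_cspace phi f cphi).

Lemma open_dist_lt (f : C) (e : E) (r : R) : open [set t | `|f t - e| < r].
Proof.
rewrite openE => t /= ft.
have cf : (fun s => `|f s - e|) @ t --> `|f t - e|.
  by apply: cvg_norm; apply: cvgB; [exact: cspace_continuous|exact: cvg_cst].
exact: (cvgr_lt _ cf).
Qed.

Lemma exists_bump (hK : hausdorff_space K) (U : set K) (t0 : K) : open U -> U t0 ->
  exists phi : K -> R, [/\ continuous phi, forall t, 0 <= phi t <= 1,
    phi t0 = 1 & forall t, ~ U t -> phi t = 0].
Proof.
move=> oU Ut0.
have [||||phi [cphi phi0 phi1 phir]] := @urysohn_ext_itv K R
    (compact_normal hK cK) (~` U) [set t0] 0 1.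
- exact: open_closedC.
- by apply: accessible_closed_set1; exact: hausdorff_accessible.
- by rewrite -subset0 => t [nU /= tt0]; apply: nU; rewrite tt0.
- exact: ltr01.
exists phi; split => //.
- by move=> t; have := phir (phi t); rewrite /= in_itv/=; apply; exists t.
- by apply: phi1; exists t0.
- by move=> t Ut; apply: phi0; exists t.
Qed.
End local.

(** * (1) implies (2): telescoping sums *)

Section implications.
Context {R : realType} {K : topologicalType} (cK : compact [set: K])
  (K0 : [set: K] !=set0) {E Z : completeNormedModType R}.
Local Notation C := (cspace cK E).
Local Notation cst := (cspace_const cK).
Implicit Types (T : {linear C -> Z}) (V U : set K) (x y : E) (eta e : R).

(* [g] is the sum of the [phi_j (u_j - y)] for [j < k], [u] is [u_k] and [s] is
   [v_1 + ... + v_k] with [u_j] close to [v_j] on [U]; the slack [1] is the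
   starting function [u_0 = y], which need not be aligned with [x]. *)
Lemma strong_daugavet_iter (hK : hausdorff_space K) T V x y eta (k : nat) :
  strong_daugavet T -> closed V -> V `<` [set: K] ->
  `|x| = 1 -> `|y| <= 1 -> 0 < eta -> eta <= 1 ->
  exists U (u g : C) (s : E),
    [/\ open U, U !=set0 & U `<=` ~` V] /\
    [/\ `|u| <= 1, vanishing_on cK E V g, `|g| <= 2 * k%:R
      & `|T (g + u - cst y)| <= k%:R * eta] /\
    [/\ forall t, U t -> `|g t + u t + y *+ k - s| <= 1 + 3 * k%:R * eta,
        `|s| <= k%:R & 1 + k%:R * (1 - eta) <= `|x + s|].
Proof.
move=> sT cV Vp x1 y1 eta0 eta1.
elim: k => [|k [U [u [g [s [[oU [t0 Ut0] UV] [[u1 gV g2 Tg] [gs s1 xs]]]]]]]].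
  exists (~` V), (cst y), 0, 0; split; [split|split; split] => //.
  - exact: closed_openC.
  - by case: Vp => _ /nonsubset; rewrite setTI.
  - by rewrite cspace_const_norm.
  - by rewrite normr0 mulr0.
  - by rewrite add0r subrr linear0 normr0 mul0r.
  - move=> t _; rewrite cspace0E add0r addr0 subr0 mulr0 mul0r addr0.
    exact: y1.
  - by rewrite normr0.
  - by rewrite mul0r !addr0 x1.
have kS : k.+1%:R = k%:R + 1 :> R by rewrite natr1.
have xs1 : 1 <= `|x + s|.
  by rewrite (le_trans _ xs)// lerDl mulr_ge0// subr_ge0.
have [d [x' [d0 de x'1 xsv]]] := align_step eta0 eta1 xs1.
have [phi [cphi phi01 phit0 phiU]] := @exists_bump R K cK hK U t0 oU Ut0.
have phi0 t : 0 <= phi t by case/andP: (phi01 t).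
have phi1 t : phi t <= 1 by case/andP: (phi01 t).
(* Subtracting [w] turns [u] into [y] where [phi] is 1 and changes nothing off [U]. Pointwise
   [u - w] is a convex combination of [u t] and [y], so it stays in the unit ball. *)
pose w : C := cspace_mul cphi (u - cst y).
have wE t : w t = phi t *: (u t - y) by [].
pose f := cspace_mul cphi (cst x') : C.
have fE t : f t = phi t *: x' by [].
have ut1 t : `|u t| <= 1 by exact: le_trans (ler_cspace_norm u t) u1.
have f1 : `|f| = 1.
  apply/eqP; rewrite eq_le; apply/andP; split.
    apply: cspace_norm_le => // t.
    by rewrite fE normrZ x'1 mulr1 ger0_norm.
  rewrite (le_trans _ (ler_cspace_norm f t0))//.
  by rewrite fE phit0 scale1r x'1.
have uw1 : `|u - w| <= 1.
  apply: cspace_norm_le => // t.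
  have -> : (u - w : C) t = (1 - phi t) *: u t + phi t *: y.
    rewrite cspaceDE cspaceNE wE scalerBl scale1r scalerBr opprB.
    by rewrite [phi t *: y - _]addrC addrA.
  rewrite (le_trans (ler_normD _ _))// !normrZ !ger0_norm ?subr_ge0//.
  have := ut1 t; have := phi0 t; have := phi1 t; have := normr_ge0 y; nra.
(* One half of [d] is spent on aligning [u'] with [f], the other on replacing [phi t1 *: x'] by
   [x']. *)
have d20 : 0 < d / 2 by rewrite divr_gt0.
have [u' [u'1 fu' Tu']] := strong_daugavet_ball sT f1 uw1 d20.
have u't1 t : `|u' t| <= 1 by exact: le_trans (ler_cspace_norm u' t) u'1.
have [t1 fu't] := cspace_norm_gt K0 fu'.
rewrite cspaceDE fE in fu't.
have fn t : `|phi t *: x'| = phi t by rewrite normrZ x'1 mulr1 ger0_norm.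
(* As [|u' t1| <= 1], a norm close to 2 forces [phi t1] close to 1, which also puts [t1] in [U]. *)
have phit1 : 1 - d / 2 < phi t1.
  have := ler_normD (phi t1 *: x') (u' t1); rewrite fn.
  by have := u't1 t1; lra.
have Ut1 : U t1.
  by apply: contrapT => /phiU phi0t; move: phit1; rewrite phi0t; lra.
have vx' : 2 - d < `|u' t1 + x'|.
  have := ler_normD (u' t1 + x') ((phi t1 - 1) *: x').
  rewrite [X in `|X|](_ : _ = phi t1 *: x' + u' t1); last first.
    by rewrite scalerBl scale1r -addrA [x' + _]addrC subrK addrC.
  rewrite [`|(_ - _) *: x'|]normrZ x'1 mulr1 ler0_norm ?subr_le0//.
  lra.
(* On the new open set [phi] is almost 1 and [u'] almost constant, so [u' t1] serves as
   [v_(k+1)]. *)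
exists ((U `&` phi @^-1` [set r | 1 - eta < r]) `&`
  [set t | `|u' t - u' t1| < eta]), u', (g + w), (s + u' t1).
split; [split|split; split] => //.
- apply: openI; last exact: open_dist_lt.
  by apply: openI => //; apply: open_comp => //; exact: open_gt.
- exists t1; split; last by rewrite /= subrr normr0.
  by split => //=; lra.
- by move=> t [[/UV]].
- move=> t Vt; rewrite cspaceDE gV// wE phiU ?scale0r ?addr0//.
  by move=> /UV; exact.
- rewrite (le_trans (ler_normD _ _))// kS mulrDr mulr1 lerD//.
  apply: cspace_norm_le => // t; rewrite wE normrZ ger0_norm//.
  have : `|u t - y| <= 2.
    by rewrite (le_trans (ler_normB _ _))//; have := ut1 t; lra.
  by have := phi0 t; have := phi1 t; nra.
(* The increment of [g + u] is [u' - (u - w)], on which [T] is small: this is the telescoping. *)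
- have -> : g + w + u' - cst y = (g + u - cst y) - (u - w - u').
    by rewrite opprB opprB !addrA [RHS](ACl (1*5*4*3*2*6)%AC) /= addrK.
  rewrite linearB /= (le_trans (ler_normB _ _))// kS mulrDl mul1r.
  by rewrite lerD//; lra.
- move=> t [[Ut /= pht] u't].
  (* The two new errors are at most [2 * eta], since [|u t - y| <= 2], and [eta]. *)
  have -> : (g + w : C) t + u' t + y *+ k.+1 - (s + u' t1) =
      (g t + u t + y *+ k - s) + ((phi t - 1) *: (u t - y) + (u' t - u' t1)).
    rewrite cspaceDE wE scalerBl scale1r opprB opprD mulrS !addrA.
    by rewrite [RHS](ACl (1*5*8*6*3*4*9*2*7)%AC) /= addrK.
  rewrite (le_trans (ler_normD _ _))//.
  have := gs _ Ut; rewrite kS.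
  have := ler_normD ((phi t - 1) *: (u t - y)) (u' t - u' t1).
  rewrite normrZ ler0_norm ?subr_le0// opprB.
  have : `|u t - y| <= 2.
    by rewrite (le_trans (ler_normB _ _))//; have := ut1 t; lra.
  have := phi1 t; have := phi0 t; nra.
- by rewrite (le_trans (ler_normD _ _))// kS lerD.
- rewrite addrA kS.
  have : `|x + s| + 1 - eta <= `|x + s + u' t1|.
    by apply: xsv => //; have := u't1 t1; lra.
  by lra.
Qed.

(* Condition (2). *)
Definition open_shift_condition T : Prop :=
  forall V, closed V -> V `<` [set: K] ->
  forall x y, unit_sphere E x -> unit_ball E y ->
  forall e, 0 < e ->
  exists (W : set K) (a : E) (h : C),
    [/\ open W, W !=set0 & W `<=` ~` V] /\
    [/\ `|a + y| < 1 + e & `|a + y + x| > 2 - e] /\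
    [/\ vanishing_on cK E V h, `|h| <= 2 + e, `|T h| < e
      & forall t, W t -> `|a - h t| < e].

(* Condition (3) is the case [N f = |T f|]. *)
Definition shift_condition (N : C -> R) : Prop :=
  forall V, closed V -> V `<` [set: K] ->
  forall x y, unit_sphere E x -> unit_ball E y ->
  forall e, 0 < e ->
  exists f : C, [/\ vanishing_on cK E V f, N f < e, `|f + cst y| < 1 + e
    & `|f + cst y + cst x| > 2 - e].

Lemma strong_daugavet_open_shift (hK : hausdorff_space K) T :
  bounded_fun_norm T -> strong_daugavet T -> open_shift_condition T.
Proof.
move=> bT sT V cV Vp x y x1 y1 e e0; have [M TM] := bT 2.
have e20 : 0 < e / 2 by rewrite divr_gt0.
have M0 : 0 <= M by rewrite (le_trans (normr_ge0 (T 0)))// TM// normr0.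
(* After division by [n], [M] pays for [T (u - cst y)], and 2 pays for [|u t|] and the starting
   slack 1. *)
have [n [eta [n0 nM eta0 eta1 etae]]] := small_parameters (M + 2) e20.
have [U [u [g [s [[oU U0 UV] [[u1 gV g2 Tg] [gs s1 xs]]]]]]] :=
  strong_daugavet_iter hK n sT cV Vp x1 y1 eta0 eta1.
have n1 : 1 <= n%:R :> R by rewrite ler1n.
have nr0 : 0 < n%:R :> R by exact: lt_le_trans n1.
have nV0 : 0 < n%:R^-1 :> R by rewrite invr_gt0.
exists U, (n%:R^-1 *: s - y), (n%:R^-1 *: g); split => //; split; split.
- rewrite subrK normrZ gtr0_norm// mulrC ltr_pdivrMr//.
  by nra.
- rewrite subrK (lt_le_trans _ (align_mean n0 (ltW eta0) _ xs))//; first by lra.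
  by rewrite (le_trans s1)// ler_peMr ?ltW// ltrDl.
- by move=> t Vt; rewrite cspaceZE gV// scaler0.
- rewrite normrZ gtr0_norm// mulrC ler_pdivrMr//.
  by rewrite (le_trans g2)// ler_wpM2r ?ltW// ltrDl.
- rewrite linearZ /= normrZ gtr0_norm// mulrC ltr_pdivrMr//.
  have -> : T g = T (g + u - cst y) - T (u - cst y).
    by rewrite -{1}(addrK (u - cst y) g) addrA linearB.
  have : `|T (u - cst y)| <= M.
    apply: TM; rewrite (le_trans (ler_normB _ _))// cspace_const_norm//.
    by rewrite (_ : 2 = 1 + 1)// lerD.
  have := ler_normB (T (g + u - cst y)) (T (u - cst y)).
  by nra.
- move=> t Ut; rewrite cspaceZE -(ltr_pM2l nr0).
  have -> : n%:R * `|n%:R^-1 *: s - y - n%:R^-1 *: g t| =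
      `|u t - (g t + u t + y *+ n - s)|.
    rewrite -{1}(gtr0_norm nr0) -normrZ !scalerBr !scalerA divff ?gt_eqF//.
    rewrite !scale1r scaler_nat !opprD opprK !addrA.
    by rewrite [in RHS](ACl (1*3*5*4*2)%AC) /= subrr add0r.
  rewrite (le_lt_trans (ler_normB _ _))//.
  have := gs _ Ut; have := le_trans (ler_cspace_norm u t) u1.
  nra.
Qed.

(** * (2) implies (3): sums over shrinking open sets *)

(** [g] is the sum of the [h_j] and [s] that of the [a_j + y]. On the current [U] the sum is close
    to [s], so the extra 2 is still unspent there. It pays for the last [h_j] that may be nonzero at
    [t]; each later step adds only [y]. *)
Lemma open_shift_iter T V x y eta (k : nat) :
  open_shift_condition T ->
  closed V -> V `<` [set: K] ->
  `|x| = 1 -> `|y| <= 1 -> 0 < eta -> eta <= 1 ->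
  exists U (g : C) (s : E),
    [/\ open U, U !=set0 & U `<=` ~` V] /\
    [/\ vanishing_on cK E V g, `|T g| <= k%:R * eta
      & forall t, `|g t + y *+ k| <= k%:R + 2 * k%:R * eta + 2] /\
    [/\ forall t, U t -> `|g t + y *+ k - s| <= k%:R * eta,
        `|s| <= k%:R * (1 + eta) & 1 + k%:R * (1 - eta) <= `|x + s|].
Proof.
move=> H cV Vp x1 y1 eta0 eta1.
elim: k => [|k [U [g [s [[oU [t0 Ut0] UV] [[gV Tg g2] [gs s1 xs]]]]]]].
  exists (~` V), 0, 0; split; [split|split; split] => //.
  - exact: closed_openC.
  - by case: Vp => _ /nonsubset; rewrite setTI.
  - by rewrite linear0 normr0 mul0r.
  - by move=> t; rewrite cspace0E addr0 normr0 mulr0 mul0r !add0r.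
  - by move=> t _; rewrite cspace0E addr0 subr0 normr0 mul0r.
  - by rewrite normr0 mul0r.
  - by rewrite mul0r !addr0 x1.
have kS : k.+1%:R = k%:R + 1 :> R by rewrite natr1.
have xs1 : 1 <= `|x + s|.
  by rewrite (le_trans _ xs)// lerDl mulr_ge0// subr_ge0.
have [d [x' [d0 de x'1 xsv]]] := align_step eta0 eta1 xs1.
have cU : closed (~` U) by exact: open_closedC.
have Up : ~` U `<` [set: K].
  by split => // /(_ t0 I); apply.
have [W [a [h [[oW W0 WU] [[ay ayx] [hU h2 Th ah]]]]]] :=
  H _ cU Up x' y x'1 y1 _ d0.
rewrite setCK in WU.
exists W, (g + h), (s + (a + y)); split; [split|split; split] => //.
- by move=> t /WU /UV.
- by move=> t Vt; rewrite cspaceDE gV// hU ?addr0// => /UV; exact.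
- rewrite linearD (le_trans (ler_normD _ _))// kS mulrDl mul1r.
  by rewrite lerD//; lra.
- move=> t; rewrite cspaceDE kS.
  have -> : g t + h t + y *+ k.+1 = (g t + y *+ k) + (h t + y).
    by rewrite mulrSr addrACA.
  rewrite (le_trans (ler_normD _ _))//.
  have [Ut|nUt] := pselect (U t); last first.
    by rewrite hU// add0r; have := g2 t; lra.
  have := ler_normD (h t) y; have := le_trans (ler_cspace_norm h t) h2.
  have : `|g t + y *+ k| <= `|g t + y *+ k - s| + `|s|.
    by rewrite -{1}(subrK s (g t + y *+ k)) ler_normD.
  have := gs _ Ut; lra.
- move=> t Wt; rewrite cspaceDE.
  have -> : g t + h t + y *+ k.+1 - (s + (a + y)) =
      (g t + y *+ k - s) - (a - h t).
    rewrite mulrSr opprB !opprD !addrA.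
    by rewrite [LHS](ACl (1*3*5*2*6*4*7)%AC) /= addrK.
  rewrite (le_trans (ler_normB _ _))// kS mulrDl mul1r lerD//.
    by apply: gs; apply: WU.
  by have := ah _ Wt; lra.
- rewrite (le_trans (ler_normD _ _))// kS mulrDl mul1r lerD//; lra.
- rewrite addrA kS.
  have : `|x + s| + 1 - eta <= `|x + s + (a + y)|.
    by apply: xsv => //; exact: ltW.
  by lra.
Qed.

Lemma open_shift_shift T :
  open_shift_condition T -> shift_condition (fun f => `|T f|).
Proof.
move=> H V cV Vp x y x1 y1 e e0.
have e20 : 0 < e / 2 by rewrite divr_gt0.
(* The 2 is the extra term in the pointwise bound on [g t + y *+ n]. *)
have [n [eta [n0 nM eta0 eta1 etae]]] := small_parameters 2 e20.
have [U [g [s [[oU [t0 Ut0] UV] [[gV Tg g2] [gs s1 xs]]]]]] :=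
  open_shift_iter n H cV Vp x1 y1 eta0 eta1.
have n1 : 1 <= n%:R :> R by rewrite ler1n.
have nr0 : 0 < n%:R :> R by exact: lt_le_trans n1.
have nV0 : 0 < n%:R^-1 :> R by rewrite invr_gt0.
have etan : 8 * eta <= e / 2 by nra.
have gyE t : n%:R^-1 *: g t + y = n%:R^-1 *: (g t + y *+ n).
  by rewrite scalerDr -[y *+ n]scaler_nat scalerA mulVf ?gt_eqF// scale1r.
exists (n%:R^-1 *: g); split.
- by move=> t Vt; rewrite cspaceZE gV// scaler0.
- rewrite linearZ /= normrZ gtr0_norm// mulrC ltr_pdivrMr//.
  by nra.
- apply: (@le_lt_trans _ _ (1 + e / 2 + 2 * eta)); last by lra.
  apply: cspace_norm_le => [|t]; first by rewrite !addr_ge0// ?mulr_ge0 ?ltW.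
  rewrite cspaceDE cspaceZE gyE normrZ gtr0_norm// mulrC ler_pdivrMr//.
  rewrite (le_trans (g2 t))//; nra.
(* One point of [U] suffices for the lower bound, since [g t0 + y *+ n] is within [n eta] of [s]. *)
- rewrite (lt_le_trans _ (ler_cspace_norm _ t0))//.
  rewrite !cspaceDE cspaceZE !cspace_constE gyE.
  have := align_mean n0 (ltW eta0) s1 xs.
  have : `|n%:R^-1 *: s + x| <= `|n%:R^-1 *: (g t0 + y *+ n) + x|
      + `|n%:R^-1 *: (g t0 + y *+ n - s)|.
    apply: le_trans (ler_normB _ _).
    by rewrite scalerBr opprB [X in _ <= `|X|]addrC addrA subrK.
  rewrite [`|_ *: (_ - s)|]normrZ gtr0_norm//.
  have : n%:R^-1 * `|g t0 + y *+ n - s| <= eta.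
    by rewrite mulrC ler_pdivrMr// mulrC gs.
  lra.
Qed.

(** * (3) implies (1), for a general seminorm *)

(** A seminorm [N] covers both [|T f|] and [|T f| + |x*(f)|]. Near a point [t0] where [|f|] is
    almost 1, [f] and [g] are almost constant; a shift [h] supported there and made for
    [f t0 / |f t0|] and [g t0] gives [u] as [g + h] rescaled. *)
Lemma shift_daugavet (N : C -> R) :
  (forall f g, N (f + g) <= N f + N g) -> (forall a f, N (a *: f) = `|a| * N f) ->
  shift_condition N ->
  forall f g : C, `|f| = 1 -> `|g| = 1 -> forall e, 0 < e ->
  exists u : C, [/\ `|u| <= 1, 2 - e < `|f + u| & N (g - u) < e].
Proof.
move=> ND NZ H f g f1 g1 e e0.
have N0 : N 0 = 0 by rewrite -(scale0r 0) NZ normr0 mul0r.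
have NN h : N (- h) = N h by rewrite -scaleN1r NZ normrN1 mul1r.
have Ng0 : 0 <= N g.
  by have := ND g (- g); rewrite subrr N0 NN; lra.
have [d [d0 d1 de]] : exists d, [/\ 0 < d, d <= 1 & d * (8 + 2 * N g) <= e].
  have c0 : 0 < 8 + 2 * N g by lra.
  exists (Num.min 1 (e / (8 + 2 * N g))); split.
  - by rewrite lt_min ltr01 divr_gt0.
  - by rewrite ge_min lexx.
  - by rewrite -ler_pdivlMr// ge_min lexx orbT.
have dNg0 : 0 <= d * N g by rewrite mulr_ge0// ltW.
have [t0 ft0] : exists t, 1 - d < `|f t|.
  by apply: cspace_norm_gt => //; rewrite f1; lra.
have ft1 t : `|f t| <= 1 by rewrite -f1; exact: ler_cspace_norm.
have gt1 t : `|g t| <= 1 by rewrite -g1; exact: ler_cspace_norm.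
have ft00 : 0 < `|f t0| by lra.
pose x := `|f t0|^-1 *: f t0.
have x1 : `|x| = 1 by rewrite normrZ normfV normr_id mulVf// gt_eqF.
have fx : `|f t0 - x| <= d.
  have -> : f t0 - x = (`|f t0| - 1) *: x.
    by rewrite scalerBl scale1r scalerA divff ?scale1r// gt_eqF.
  by rewrite normrZ x1 mulr1 ler0_norm ?subr_le0//; lra.
pose U := [set t | `|f t - f t0| < d] `&` [set t | `|g t - g t0| < d].
have oU : open U by apply: openI; exact: open_dist_lt.
have Ut0 : U t0 by split; rewrite /= subrr normr0.
have cU : closed (~` U) by exact: open_closedC.
have Up : ~` U `<` [set: K] by split => // /(_ t0 I); apply.
have [h [hU Nh hy hyx]] := H _ cU Up x (g t0) x1 (gt1 t0) _ d0.
have [t1] := cspace_norm_gt K0 hyx.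
rewrite !cspaceDE !cspace_constE => ht1.
(* Off [U] the shift vanishes, so [g t0 + x] already has norm almost 2 and [g] itself is a
   solution. *)
have [[/= ft gt]|nUt1] := pselect (U t1); last first.
  exists g; split; first by rewrite g1.
  - rewrite (lt_le_trans _ (ler_cspace_norm _ t0))// cspaceDE.
    move: ht1; rewrite hU// add0r => gx.
    have := ler_normB (f t0 + g t0) (f t0 - x).
    rewrite [f t0 + _]addrC addrKA opprK; lra.
  - by rewrite subrr N0.
(* One [d] comes from the bound on [h + cst (g t0)], the other from the oscillation of [g] on
   [U]. *)
pose c := 1 + 2 * d.
have c0 : 0 < c by rewrite /c; lra.
have c1 : 1 <= c by rewrite /c; lra.
have ghc : `|g + h| <= c.
  apply: cspace_norm_le => [|t]; first exact: ltW.
  rewrite cspaceDE.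
  have [[_ /= gt']|nUt] := pselect (U t).
    have -> : g t + h t = (g t - g t0) + (h t + g t0).
      by rewrite [h t + _]addrC addrA subrK.
    rewrite (le_trans (ler_normD _ _))//.
    have := ler_cspace_norm (h + cst (g t0)) t.
    rewrite cspaceDE cspace_constE => ht.
    have := le_lt_trans ht hy; rewrite /c; lra.
  by rewrite hU// addr0 (le_trans (gt1 t)).
pose u := c^-1 *: (g + h).
have u1 : `|u| <= 1.
  by rewrite normrZ gtr0_norm ?invr_gt0// mulrC ler_pdivrMr// mul1r.
have ghu : g + h = c *: u by rewrite scalerA divff ?scale1r// gt_eqF.
exists u; split => //.
- rewrite (lt_le_trans _ (ler_cspace_norm _ t1))// cspaceDE.
  have ut1 : `|u t1| <= 1 by exact: le_trans (ler_cspace_norm u t1) u1.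
  (* The four corrections cost at most [d], [d], [d] and [2 * d]. *)
  have E1 : h t1 + g t0 + x = (f t1 + u t1) - (f t1 - f t0) - (f t0 - x)
      - (g t1 - g t0) + (2 * d) *: u t1.
    have -> : (2 * d) *: u t1 = g t1 + h t1 - u t1.
      have -> : g t1 + h t1 = c *: u t1 by rewrite -cspaceDE ghu.
      by rewrite /c scalerDl scale1r [RHS]addrC addrA addNr add0r.
    rewrite !opprB !addrA.
    by rewrite [RHS](ACl (10*7*5*1*4*3*6*2*11*9*8)%AC) /= !addrK.
  move: ht1; rewrite E1 => ht1.
  have := ler_normD (f t1 + u t1 - (f t1 - f t0) - (f t0 - x) - (g t1 - g t0))
    ((2 * d) *: u t1).
  have := ler_normB (f t1 + u t1 - (f t1 - f t0) - (f t0 - x)) (g t1 - g t0).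
  have := ler_normB (f t1 + u t1 - (f t1 - f t0)) (f t0 - x).
  have := ler_normB (f t1 + u t1) (f t1 - f t0).
  have : `|(2 * d) *: u t1| <= 2 * d.
    by rewrite normrZ gtr0_norm ?mulr_gt0// ler_piMr// mulr_ge0// ltW.
  lra.
- have -> : g - u = c^-1 *: ((2 * d) *: g - h).
    have -> : (2 * d) *: g - h = c *: g - (g + h).
      by rewrite /c scalerDl scale1r opprD addrA [g + _]addrC addrK.
    by rewrite scalerBr scalerA mulVf ?gt_eqF// scale1r.
  rewrite NZ gtr0_norm ?invr_gt0// mulrC ltr_pdivrMr//.
  have := ND ((2 * d) *: g) (- h); rewrite NN NZ gtr0_norm ?mulr_gt0//.
  have : e <= e * c by rewrite ler_peMr// ltW.
  lra.
Qed.

(** * Narrowness when there are no isolated points *)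

Lemma split_open (hK : hausdorff_space K) U :
  isolated [set: K] = set0 -> open U -> U !=set0 ->
  exists A B, [/\ open A, open B, A !=set0, B !=set0 & A `&` B = set0]
    /\ A `<=` U /\ B `<=` U.
Proof.
move=> iK oU [t Ut].
have [s Us st] : exists2 s, U s & s != t.
  apply: contrapT => nU; suff : isolated [set: K] t by rewrite iK.
  split; first by rewrite inE.
  exists U; first exact: open_nbhs_nbhs.
  rewrite setIT; apply/seteqP; split => [s Us|_ ->//] /=.
  by apply: contrapT => /eqP st; apply: nU; exists s.
have [[A B] /= [sA tB] [oA oB AB]] : exists2 AB : set K * set K,
    (s \in AB.1) /\ (t \in AB.2) & [/\ open AB.1, open AB.2 & AB.1 `&` AB.2 == set0].
  by move: hK; rewrite open_hausdorff => /(_ _ _ st)[AB [? ?] []]; exists AB.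
exists (U `&` A), (U `&` B); split; last by split; apply: subIsetl.
split; [exact: openI|exact: openI| | |].
- by exists s; split => //; rewrite inE in sA.
- by exists t; split => //; rewrite inE in tB.
- by rewrite setIACA (eqP AB) setI0.
Qed.

(** If this failed, each shift for [N] supported in an open set off [V] would satisfy
    [|xs f| >= e / 2]. Up to signs, [n] such shifts with disjoint supports add up to a function of
    norm at most [2 + e / 2] with [xs] at least [n e / 2], against boundedness. *)
Lemma shift_functional (hK : hausdorff_space K) (N : C -> R)
    (xs : {linear C -> R^o}) : (forall f, N (- f) = N f) ->
  isolated [set: K] = set0 -> bounded_fun_norm xs ->
  shift_condition N -> shift_condition (fun f => N f + `|xs f|).
Proof.
move=> NN iK bxs H V cV Vp x y x1 y1 e e0.
apply: contrapT => nf.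
have e20 : 0 < e / 2 by rewrite divr_gt0.
have step U : open U -> U !=set0 -> U `<=` ~` V ->
    exists f, [/\ vanishing_on cK E (~` U) f, `|f| <= 2 + e / 2 & e / 2 <= xs f].
  move=> oU [t0 Ut0] UV.
  have cU : closed (~` U) by exact: open_closedC.
  have Up : ~` U `<` [set: K] by split => // /(_ t0 I); apply.
  have [f [fU Nf fy fyx]] := H _ cU Up x y x1 y1 _ e20.
  have f2 : `|f| <= 2 + e / 2.
    have := ler_normB (f + cst y) (cst y); rewrite addrK cspace_const_norm//.
    by have : `|y| <= 1 by []; lra.
  have xf : e / 2 <= `|xs f|.
    rewrite leNgt; apply/negP => xf; apply: nf; exists f; split.
    - by move=> t Vt; apply: fU => /UV; exact.
    - by rewrite [ltRHS]splitr ltrD.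
    - by rewrite (lt_trans fy)// ltrD2l ltr_pdivrMr// ltr_pMr// ltr1n.
    - by rewrite (lt_trans _ fyx)//; lra.
  have [xf0|xf0] := leP 0 (xs f).
    by exists f; split; rewrite // -(ger0_norm xf0).
  exists (- f); split; last by rewrite linearN -(ltr0_norm xf0).
    by move=> t Ut; rewrite cspaceNE fU ?oppr0.
  by rewrite normrN.
have sum (n : nat) U : open U -> U !=set0 -> U `<=` ~` V ->
    exists g, [/\ vanishing_on cK E (~` U) g, `|g| <= 2 + e / 2
      & n%:R * (e / 2) <= xs g].
  elim: n U => [|n IHn] U oU U0 UV.
    exists 0; split => //.
      by rewrite normr0; lra.
    by rewrite linear0 mul0r.
  (* One piece carries the [n] previous shifts, the other the new one. *)
  have [A [B [[oA oB A0 B0 AB] [AU BU]]]] := split_open hK iK oU U0.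
  have [g [gA g2 xg]] := IHn _ oA A0 (subset_trans AU UV).
  have [f [fB f2 xf]] := step _ oB B0 (subset_trans BU UV).
  exists (g + f); split.
  - move=> t Ut; rewrite cspaceDE gA ?fB ?addr0//.
      by move=> /BU.
    by move=> /AU.
  - apply: cspace_norm_le => [|t]; first by lra.
    rewrite cspaceDE; have [At|At] := pselect (A t).
      rewrite fB ?addr0 ?(le_trans (ler_cspace_norm g t))// => Bt.
      by have : (A `&` B) t by []; rewrite AB.
    by rewrite gA// add0r (le_trans (ler_cspace_norm f t)).
  - by rewrite linearD -natr1 mulrDl mul1r lerD.
have [M xsM] := bxs (2 + e / 2).
have [n [_ [_ nM _ _ _]]] := small_parameters M e20.
have [g [_ g2 xg]] : exists g, [/\ vanishing_on cK E (~` (~` V)) g,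
    `|g| <= 2 + e / 2 & n%:R * (e / 2) <= xs g].
  apply: sum => //; first exact: closed_openC.
  by case: Vp => _ /nonsubset; rewrite setTI.
have := xsM _ g2; rewrite leNgt => /negP; apply.
by rewrite (lt_le_trans nM)// (le_trans xg)// ler_norm.
Qed.

End implications.

(** * The equivalences assembled *)

Theorem theorem3p7 (R : realType) (K : topologicalType)
    (K0 : [set: K] !=set0) (cK : compact [set: K]) (hK : hausdorff_space K)
    (E Z : completeNormedModType R)
    (T : {linear cspace cK E -> Z}) (bT : bounded_fun_norm T) :
  [<-> (* (1) *)
       strong_daugavet T;
       (* (2) *)
       forall V : set K, closed V -> V `<` [set: K] ->
       forall x y : E, unit_sphere E x -> unit_ball E y ->
       forall eps : R, 0 < eps ->
       exists (W : set K) (e : E) (h : cspace cK E),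
         [/\ open W, W !=set0 & W `<=` ~` V] /\
         [/\ `|e + y| < 1 + eps & `|e + y + x| > 2 - eps] /\
         [/\ vanishing_on cK E V h, `|h| <= 2 + eps, `|T h| < eps
           & forall t, W t -> `|e - h t| < eps];
       (* (3) *)
       forall V : set K, closed V -> V `<` [set: K] ->
       forall x y : E, unit_sphere E x -> unit_ball E y ->
       forall eps : R, 0 < eps ->
       exists f : cspace cK E,
         [/\ vanishing_on cK E V f,
             `|T f| < eps,
             `|f + cspace_const cK y| < 1 + eps
           & `|f + cspace_const cK y + cspace_const cK x| > 2 - eps] ]
  /\
  (isolated [set: K] = set0 -> (strong_daugavet T <-> narrow T)).
Proof.
split.
  tfae=> [sT|oT|sT].
  - exact: strong_daugavet_open_shift.
  - exact: open_shift_shift.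
  - move=> f g f1 g1 e e0; apply: (shift_daugavet K0 _ _ sT) => //.
    + by move=> f' g'; rewrite linearD ler_normD.
    + by move=> a f'; rewrite linearZ normrZ.
move=> iK; split=> [sT|nT].
  move=> f g f1 g1 xs bxs e e0.
  have {}sT : shift_condition (fun f => `|T f| + `|xs f|).
    apply: shift_functional => //; first by move=> h; rewrite linearN normrN.
    exact/open_shift_shift/strong_daugavet_open_shift.
  apply: (shift_daugavet K0 _ _ sT) => //.
  - move=> f' g'; rewrite !linearD addrACA.
    by rewrite lerD// ler_normD.
  - by move=> a f'; rewrite !linearZ !normrZ mulrDr.
move=> f g f1 g1 e e0.
(* Narrowness tested on the zero functional is the strong Daugavet property. *)
have b0 : bounded_fun_norm (\0 : {linear cspace cK E -> R^o}).
  by move=> r; exists 0 => h _; rewrite normr0.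
have [u [u1 fu Tu]] := nT f g f1 g1 _ b0 e e0.
by exists u; split => //; move: Tu; rewrite normr0 addr0.
Qed.
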